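(* Let $\mathcal{C}$ be an arbitrary labelled well-quasi-ordered permutation class, and let $\mathcal{D}$ be a monotone class, i.e. $\mathcal{D}=\mathsf{Av}(21)$ or $\mathcal{D}=\mathsf{Av}(12)$. Then the juxtaposition $[\mathcal{C}\ \mathcal{D}]$ is labelled well-quasi-ordered.
   Context: A permutation of length $n$ is an ordering $\pi=\pi(1)\cdots\pi(n)$ of $[n]$; $\sigma$ of length $k$ is contained in $\pi$ if some subsequence $\pi(i_1)\cdots\pi(i_k)$, $i_1<\cdots<i_k$, is order isomorphic to $\sigma$. A permutation class is a downward-closed set under containment. $\mathsf{Av}(21)$ is the class of increasing permutations, $\mathsf{Av}(12)$ the class of decreasing permutations. The juxtaposition $[\mathcal{C}\ \mathcal{D}]$ is the class of all permutations that are concatenations $\sigma\tau$ with $\sigma$ order isomorphic to a member of $\mathcal{C}$ and $\tau$ order isomorphic to a member of $\mathcal{D}$. A quasi-order is wqo if it has no infinite strictly descending chain and no infinite antichain. For a quasi-order $(L,\le_L)$, $\mathcal{C}\wr L$ is the set of pairs $(\pi,\ell_\pi)$ with $\pi\in\mathcal{C}$ and $\ell_\pi$ a map from the indices of $\pi$ to $L$, ordered by $(\sigma,\ell_\sigma)\le(\pi,\ell_\pi)$ if there are $i_1<\cdots<i_m$ ($m$ the length of $\sigma$) with $\pi(i_1)\cdots\pi(i_m)$ order isomorphic to $\sigma$ and $\ell_\sigma(j)\le_L\ell_\pi(i_j)$ for all $j$. A class $\mathcal{C}$ is labelled well-quasi-ordered (lwqo) if $\mathcal{C}\wr L$ is wqo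 for every wqo $(L,\le_L)$. *)

(* Defs.v *)
From mathcomp Require Import all_boot all_fingroup.

Set Implicit Arguments.
Unset Strict Implicit.
Unset Printing Implicit Defensive.

(* A permutation of length n is an element of 'S_n, in one-line notation      *)
(* p ord0, ..., p ord_max (indices and values both start at 0). The empty     *)
(* permutation, of length 0, is allowed.                                      *)

Definition order_iso (k m n : nat) (u : 'I_k -> 'I_m) (v : 'I_k -> 'I_n) : Prop :=
  forall i j : 'I_k, (u i < u j) = (v i < v j).

Definition embedding (m n : nat) (s : 'S_m) (p : 'S_n) (f : 'I_m -> 'I_n) : Prop :=
  (forall i j : 'I_m, i < j -> f i < f j) /\ order_iso s (p \o f).

Definition contained (m n : nat) (s : 'S_m) (p : 'S_n) : Prop :=
  exists f : 'I_m -> 'I_n, embedding s p f.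

Definition downward_closed (C : forall n, 'S_n -> Prop) : Prop :=
  forall m n (s : 'S_m) (p : 'S_n), contained s p -> C n p -> C m s.

Record perm_class := PermClass {
  mem_class :> forall n, 'S_n -> Prop;
  mem_class_closed : downward_closed mem_class
}.

Definition class_eq (C D : perm_class) : Prop :=
  forall n (p : 'S_n), C n p <-> D n p.

Lemma contained_trans l m n (q : 'S_l) (s : 'S_m) (p : 'S_n) :
  contained q s -> contained s p -> contained q p.
Proof.
move=> [f [fm fo]] [g [gm go]]; exists (g \o f); split.
  by move=> i j /fm /gm.
by move=> i j; rewrite fo /= go.
Qed.

Lemma avoid_closed k (b : 'S_k) : downward_closed (fun n p => ~ contained b p).
Proof. by move=> m n s p sp bp bs; apply: bp; apply: contained_trans sp. Qed.

Definition Av (k : nat) (b : 'S_k) : perm_class := PermClass (@avoid_closed k b).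

Definition perm12 : 'S_2 := 1%g.
Definition perm21 : 'S_2 := tperm ord0 ord_max.

Lemma contained2 (b : 'S_2) n (p : 'S_n) : contained b p <->
  exists i j : 'I_n, i < j /\ (p i < p j) = (b ord0 < b ord_max).
Proof.
split=> [[f [fm fo]] | [i [j [ij pij]]]].
  by exists (f ord0), (f ord_max); split; [exact: fm | rewrite fo].
exists (fun x => if x == ord0 then i else j); split.
  by case=> [[|[|//]] ?] [[|[|//]] ?].
have bneq : b ord0 != b ord_max by rewrite (inj_eq perm_inj).
have pneq : p i != p j by rewrite (inj_eq perm_inj) -val_eqE ltn_eqF.
have E0 (h : 0 < 2) : Ordinal h = ord0 by apply: val_inj.
have E1 (h : 1 < 2) : Ordinal h = ord_max by apply: val_inj.
case=> [[|[|//]] h] [[|[|//]] h']; rewrite ?E0 ?E1 /= ?ltnn //.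
have flip (x y : nat) : x != y -> (y < x) = ~~ (x < y) by case: ltngtP.
by rewrite (flip _ _ bneq) (flip _ _ pneq) pij.
Qed.

Lemma Av21P n (p : 'S_n) :
  Av perm21 n p <-> (forall i j : 'I_n, i < j -> p i < p j).
Proof.
split=> [H i j ij | H /contained2[i [j [ij]]]].
  case E: (p i < p j) => //; case: H; apply/contained2.
  by exists i, j; rewrite E /perm21 tpermL tpermR.
by rewrite (H _ _ ij) /perm21 tpermL tpermR.
Qed.

Lemma Av12P n (p : 'S_n) :
  Av perm12 n p <-> (forall i j : 'I_n, i < j -> p j < p i).
Proof.
split=> [H i j ij | H /contained2[i [j [ij]]]].
  case: (ltngtP (p i) (p j)) => // [E | /val_inj/perm_inj E].
    by case: H; apply/contained2; exists i, j; rewrite E /perm12 !perm1.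
  by rewrite E ltnn in ij.
by rewrite /perm12 !perm1 ltnNge (ltnW (H _ _ ij)).
Qed.

Definition monotone_class (D : perm_class) : Prop :=
  class_eq D (Av perm21) \/ class_eq D (Av perm12).

Definition juxt_mem (C D : perm_class) (n : nat) (p : 'S_n) : Prop :=
  exists (k m : nat) (e : k + m = n) (s : 'S_k) (t : 'S_m),
    [/\ C k s, D m t,
        order_iso (fun i => p (cast_ord e (lshift m i))) s &
        order_iso (fun i => p (cast_ord e (rshift k i))) t].

Lemma standardize k n (u : 'I_k -> 'I_n) :
  injective u -> exists s : 'S_k, order_iso u s.
Proof.
move=> uI; pose A i := [set j | u j < u i].
have Alt i : #|A i| < k.
  rewrite -[X in _ < X]card_ord -cardsT; apply: proper_card.
  by rewrite properT; apply/eqP=> /setP/(_ i); rewrite !inE ltnn.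
have Amono i j : (u i < u j) = (#|A i| < #|A j|).
  case: ltnP => [ij | ji]; apply/esym.
    apply: proper_card; apply/properP; split.
      by apply/subsetP=> x; rewrite !inE => /ltn_trans; apply.
    by exists i; rewrite !inE ?ltnn.
  apply/negbTE; rewrite -leqNgt; apply: subset_leq_card.
  by apply/subsetP=> x; rewrite !inE => /leq_trans; apply.
have sI : injective (fun i => Ordinal (Alt i)).
  move=> i j [E]; apply/uI/val_inj.
  by case: (ltngtP (u i) (u j)) => //; rewrite Amono E ltnn.
by exists (perm sI) => i j; rewrite !permE Amono.
Qed.

Lemma initial_segment l (P : pred 'I_l) :
  (forall i j : 'I_l, i < j -> P j -> P i) ->
  exists2 a, a <= l & forall i : 'I_l, P i = (i < a).
Proof.
elim: l P => [|l IH] P Pd; first by exists 0 => // -[].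
have [|a al aP] := IH (fun i => P (widen_ord (leqnSn l) i)).
  by move=> i j ij; apply: Pd.
case Pm: (P ord_max).
  exists l.+1 => // i; rewrite ltn_ord.
  have := leq_ord i; rewrite leq_eqVlt => /orP[/eqP E | il].
    by rewrite -Pm; congr (P _); apply: val_inj.
  by apply: Pd Pm.
exists a; first exact: leqW.
move=> i; have := leq_ord i; rewrite leq_eqVlt => /orP[/eqP E | il].
  have -> : i = ord_max by apply: val_inj.
  by rewrite Pm /= ltnNge al.
have /= <- := aP (Ordinal il).
by congr (P _); apply: val_inj.
Qed.

Lemma juxt_closed C D : downward_closed (juxt_mem C D).
Proof.
move=> l n q p [f [fm fo]] [k [m [e [s [t [Cs Dt os ot]]]]]].
have [|a al aP] := @initial_segment l (fun i => f i < k).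
  by move=> i j /fm /ltn_trans; apply.
pose b := l - a; have e' : a + b = l by rewrite subnKC.
pose L i := cast_ord e' (lshift b i); pose R i := cast_ord e' (rshift a i).
have [|s' s'P] := @standardize a l (fun i => q (L i)).
  by move=> i j /perm_inj/cast_ord_inj/lshift_inj.
have [|t' t'P] := @standardize b l (fun i => q (R i)).
  by move=> i j /perm_inj/cast_ord_inj/rshift_inj.
exists a, b, e', s', t'; split=> //.
- have gP i : f (L i) < k by rewrite aP /= ltn_ord.
  apply: mem_class_closed Cs; exists (fun i => Ordinal (gP i)).
  split=> [i j ij | i j]; first exact: fm.
  rewrite -s'P fo /= -os; congr (p _ < p _); exact: val_inj.
- have kf i : k <= f (R i) by rewrite leqNgt aP /= -leqNgt leq_addr.
  have gP i : f (R i) - k < m by rewrite ltn_subLR // e.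
  apply: mem_class_closed Dt; exists (fun i => Ordinal (gP i)).
  split=> [i j ij | i j] /=.
    by apply: ltn_sub2r; [apply: leq_ltn_trans (kf i) _|]; apply: fm;
      rewrite /= ltn_add2l.
  rewrite -t'P fo /= -ot.
  by congr (p _ < p _); apply: val_inj; rewrite /= subnKC.
Qed.

Definition juxtaposition (C D : perm_class) : perm_class :=
  PermClass (@juxt_closed C D).

Definition quasi_order (L : Type) (le : L -> L -> Prop) : Prop :=
  (forall x, le x x) /\ (forall x y z, le x y -> le y z -> le x z).

Definition descending_chain (L : Type) (le : L -> L -> Prop) (x : nat -> L) : Prop :=
  forall i, le (x i.+1) (x i) /\ ~ le (x i) (x i.+1).

Definition antichain (L : Type) (le : L -> L -> Prop) (x : nat -> L) : Prop :=
  forall i j, i <> j -> ~ le (x i) (x j).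

Definition wqo (L : Type) (le : L -> L -> Prop) : Prop :=
  [/\ quasi_order le,
      ~ (exists x : nat -> L, descending_chain le x) &
      ~ (exists x : nat -> L, antichain le x)].

Record labelled (C : perm_class) (L : Type) := Labelled {
  lab_length : nat;
  lab_perm : 'S_lab_length;
  lab_mem : C lab_length lab_perm;
  label : 'I_lab_length -> L
}.
Arguments label {C L} l _.

Definition labelled_le (C : perm_class) (L : Type) (le : L -> L -> Prop)
    (a b : labelled C L) : Prop :=
  exists f : 'I_(lab_length a) -> 'I_(lab_length b),
    embedding (lab_perm a) (lab_perm b) f /\
    forall j, le (label a j) (label b (f j)).

Definition lwqo (C : perm_class) : Prop :=
  forall (L : Type) (le : L -> L -> Prop),
    wqo le -> wqo (@labelled_le C L le).

(* Main.v *)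
(** Let [p] be the concatenation of a left part [s], from [C], and a monotone
    right part. Attach to each entry of [s] the word of labels, read from left
    to right, of those right entries whose value lies directly below it, that
    is, between it and the next smaller entry of [s]; one further word records
    the right entries above all of [s]. An embedding of these codes
    reconstructs an embedding of the permutations, since within one gap the
    right entries are monotone. The codes range over [C] labelled by [L * L^*],
    times [L^*], which is wqo by Higman's lemma and the hypothesis on [C]. *)

Require Import Defs.
From mathcomp Require Import all_boot all_fingroup.
From mathcomp Require Import boolp.

Set Implicit Arguments.
Unset Strict Implicit.
Unset Printing Implicit Defensive.

(** * Good sequences and well-quasi-orders *)

Definition good (T : Type) (le : T -> T -> Prop) : Prop :=
  forall x : nat -> T, exists i j, i < j /\ le (x i) (x j).

Lemma infinitely_often (P : nat -> Prop) :
  (forall n, exists2 i, n <= i & P i) ->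
  exists2 u : nat -> nat, {homo u : i j / i < j} & forall k, P (u k).
Proof.
move=> infP.
have /choice[g gP] : forall n, exists i, n <= i /\ P i.
  by move=> n; have [i] := infP n; exists i.
exists (fun k => iter k (g \o succn) (g 0)).
  apply: homo_ltn => [? ? ?|k /=]; first exact: ltn_trans.
  by case: (gP (iter k (g \o succn) (g 0)).+1).
by case=> [|k] /=; [case: (gP 0) | case: (gP (iter k (g \o succn) (g 0)).+1)].
Qed.

Section Good.
Variables (T : Type) (le : T -> T -> Prop).

Lemma good_wqo : quasi_order le -> good le -> wqo le.
Proof.
move=> qo leG; split=> //; case=> x xP.
  have [i [j [ij leij]]] := leG x.
  have dec : forall i j, i < j -> le (x j) (x i).
    apply: (@homo_ltn _ x (fun a b => le b a)) => [b a c ab bc|k].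
      exact: qo.2 bc ab.
    by case: (xP k).
  have [_] := xP i; apply.
  move: ij; rewrite leq_eqVlt => /orP[/eqP->//|/dec].
  exact: qo.2 leij.
have [i [j [ij]]] := leG x.
by apply: xP => eij; rewrite eij ltnn in ij.
Qed.

(** In a sequence without a good pair, if infinitely many terms have no later term below them, these
    form an antichain. Otherwise, from some index [n] on, every term has a later one below it, and
    following these gives a chain, strictly descending by badness. *)
Lemma wqo_good : wqo le -> good le.
Proof.
move=> [qo ndc nac] x; apply: contrapT => bad.
have badx i j : i < j -> ~ le (x i) (x j).
  by move=> ij leij; apply: bad; exists i, j.
have [|u u_lt uP] := @infinitely_often
    (fun i => forall j, i < j -> ~ le (x j) (x i)).
  move=> n; apply: contrapT => nomin.
  have next i : exists j, n <= i -> i < j /\ le (x j) (x i).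
    (* The value 0 is a dummy for indices below [n], which the iteration from [n] never visits. *)
    case: (leqP n i) => ni; last by exists 0.
    apply: contrapT => noj; apply: nomin; exists i => // j ij leji.
    by apply: noj; exists j.
  have /choice[h hP] := next.
  have geh k : n <= iter k h n.
    elim: k => //= k IHk.
    by have [lt_h _] := hP _ IHk; apply: leq_trans IHk (ltnW lt_h).
  apply: ndc; exists (fun k => x (iter k h n)) => k /=.
  have [lt_h le_h] := hP _ (geh k); split=> //.
  exact: badx.
apply: nac; exists (x \o u) => i j /eqP; rewrite neq_ltn => /orP[]/u_lt ij /=.
  exact: badx.
exact: uP.
Qed.

(** Terms with no later term above them occur only up to some index, since infinitely many would
    form a sequence without a good pair. Past that index, one climbs step by step. *)
Lemma good_subseq (x : nat -> T) : quasi_order le -> good le ->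
  exists2 u : nat -> nat, {homo u : i j / i < j} &
    forall i j, i < j -> le (x (u i)) (x (u j)).
Proof.
move=> qo leG.
have [n nP] : exists n, forall i, n <= i -> exists j, i < j /\ le (x i) (x j).
  apply: contrapT => noN.
  have [|u u_lt uP] := @infinitely_often
      (fun i => forall j, i < j -> ~ le (x i) (x j)).
    move=> n; apply: contrapT => noi; apply: noN; exists n => i ni.
    apply: contrapT => noj; apply: noi; exists i => // j ij leij.
    by apply: noj; exists j.
  have [i [j [/u_lt ij leij]]] := leG (x \o u).
  exact: uP leij.
have /choice[h hP] : forall i, exists j, n <= i -> i < j /\ le (x i) (x j).
  move=> i; case: (leqP n i) => [/nP[j]|]; last by exists 0.
  by exists j.
have geh k : n <= iter k h n.
  elim: k => //= k IHk.
  by have [lt_h _] := hP _ IHk; apply: leq_trans IHk (ltnW lt_h).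
exists (fun k => iter k h n).
  by apply: homo_ltn => [? ? ?|k]; [exact: ltn_trans | case: (hP _ (geh k))].
apply: (@homo_ltn _ (fun k => x (iter k h n)) le) => [b a c|k].
  exact: qo.2.
by case: (hP _ (geh k)).
Qed.

(** [code] is a relation because an object may have several codes, as a juxtaposition may be cut at
    several places. *)
Lemma good_coding (T' : Type) (le' : T' -> T' -> Prop) (code : T' -> T -> Prop) :
  (forall a, exists c, code a c) ->
  (forall a b c d, code a c -> code b d -> le c d -> le' a b) ->
  good le -> good le'.
Proof.
move=> /choice[f fP] codeP leG x.
have [i [j [ij leij]]] := leG (f \o x).
by exists i, j; split=> //; apply: codeP leij; apply: fP.
Qed.

End Good.

Definition prod_le (A B : Type) (leA : A -> A -> Prop) (leB : B -> B -> Prop)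
  (a b : A * B) : Prop := leA a.1 b.1 /\ leB a.2 b.2.

(** Along a subsequence that ascends in the first coordinate, a good pair for the second is good for
    both. *)
Lemma wqo_prod (A B : Type) (leA : A -> A -> Prop) (leB : B -> B -> Prop) :
  wqo leA -> wqo leB -> wqo (prod_le leA leB).
Proof.
move=> wA wB; have [[rA tA] _ _] := wA; have [[rB tB] _ _] := wB.
apply: good_wqo.
  by split=> [x|x y z [? ?] [? ?]]; split; eauto.
move=> x.
have [u u_lt uP] := good_subseq (fst \o x) (conj rA tA) (wqo_good wA).
have [i [j [ij leij]]] := wqo_good wB (snd \o x \o u).
by exists (u i), (u j); split; [exact: u_lt | split=> //; apply: uP].
Qed.

(** * Higman's lemma, by the Nash-Williams minimal bad sequence *)

Section Higman.
Variables (L : Type) (le : L -> L -> Prop).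

Inductive subword : seq L -> seq L -> Prop :=
| subword_nil v : subword [::] v
| subword_skip y u v : subword u v -> subword u (y :: v)
| subword_keep x y u v : le x y -> subword u v -> subword (x :: u) (y :: v).

Lemma subword_quasi_order : quasi_order le -> quasi_order subword.
Proof.
move=> [lexx le_trans]; split=> [|u v w uv vw].
  by elim=> [|x u IHu]; constructor.
elim: vw u uv => [v' u uv|y u' v' _ IH u /IH|x y u' v' xy _ IH u uv].
- by inversion uv; constructor.
- exact: subword_skip.
inversion uv; subst; first exact: subword_nil.
  by apply: subword_skip; apply: IH.
by apply: subword_keep; [apply: le_trans xy | apply: IH].
Qed.

Definition bad (x : nat -> seq L) : Prop :=
  forall i j, i < j -> ~ subword (x i) (x j).

(** Stage [n] keeps the first [n] terms of a bad sequence and makes term [n] as short as possible.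
    The limit [w] is the diagonal of the stages. *)
Lemma minimal_bad (x0 : nat -> seq L) : bad x0 ->
  exists2 w, bad w & forall n y, bad y -> (forall i, i < n -> y i = w i) ->
    size (w n) <= size (y n).
Proof.
move=> bad0.
pose better n (x y : nat -> seq L) := forall i, i < n -> y i = x i.
have step (nx : nat * (nat -> seq L)) : exists y, bad nx.2 -> [/\ bad y, better nx.1 nx.2 y &
    forall z, bad z -> better nx.1 nx.2 z -> size (y nx.1) <= size (z nx.1)].
  case: nx => n x /=; case: (pselect (bad x)) => [badx|]; last by exists x.
  pose P k := `[< exists y, [/\ bad y, better n x y & size (y n) = k] >].
  have exP : exists k, P k by exists (size (x n)); apply/asboolP; exists x.
  case: (ex_minnP exP) => k /asboolP[y [bady xy <-]] ymin.
  exists y => _; split=> // z badz xz.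
  by apply: ymin; apply/asboolP; exists z.
have {step} /choice[next nextP] := step.
pose X := fix X n := if n is n'.+1 then next (n', X n') else x0.
have badX n : bad (X n).
  elim: n => [|n IHn]; first exact: bad0.
  have [badn _ _] := nextP (n, X n) IHn; exact: badn.
have XE n i : i < n -> X n i = X i.+1 i.
  elim: n => // n IHn; rewrite ltnS leq_eqVlt => /orP[/eqP->//|ltin].
  have [_ agree _] := nextP (n, X n) (badX n).
  by rewrite -(IHn ltin); apply: agree.
exists (fun n => X n.+1 n) => [i j ij|n y bady yE].
  (* Both terms of [w] occur in the single bad sequence [X j.+1]. *)
  rewrite -(XE j.+1 i); last by rewrite ltnS ltnW.
  exact: badX.
have [_ _] := nextP (n, X n) (badX n); apply=> // i /= ltin.
by rewrite yE // XE.
Qed.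

Lemma higman : wqo le -> wqo subword.
Proof.
move=> wle; have [qo _ _] := wle.
apply: good_wqo; first exact: subword_quasi_order.
move=> x; apply: contrapT => nx.
have {nx} badx : bad x by move=> i j ij xij; apply: nx; exists i, j.
have [w badw wmin] := minimal_bad badx.
(* An empty word would embed in its successor, so each [w n] has a head and a tail. *)
have /choice[av avE] n : exists av, w n = av.1 :: av.2.
  case E: (w n) => [|a v]; last by exists (a, v).
  by case: (badw n n.+1 (leqnn _)); rewrite E; constructor.
have [u u_lt uP] := good_subseq (fst \o av) qo (wqo_good wle).
(* From position [u 0] on, [w] is replaced by the tails along [u], where heads ascend. The result is
   still bad but shorter at [u 0], against minimality. *)
pose y n := if n < u 0 then w n else (av (u (n - u 0))).2.
have u0le k : u 0 <= u k by case: k => // k; apply/ltnW/u_lt.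
have bady : bad y.
  move=> i j ij; rewrite /y; case: (ltnP i (u 0)) => iu.
    case: ltnP => ju; first exact: badw.
    move=> wij; apply: (badw i (u (j - u 0))).
      exact: leq_trans iu (u0le _).
    by rewrite (avE (u _)); apply: subword_skip.
  rewrite ltnNge (leq_trans iu (ltnW ij)) /= => vij.
  have ij' : i - u 0 < j - u 0 by rewrite ltn_sub2r // (leq_ltn_trans iu ij).
  apply: (badw _ _ (u_lt _ _ ij')).
  by rewrite !avE; apply: subword_keep => //; apply: uP.
have yw i : i < u 0 -> y i = w i by rewrite /y => ->.
by have := wmin (u 0) y bady yw; rewrite /y ltnn subnn avE /= ltnn.
Qed.

End Higman.

(** Turns an embedding of label words into a matching of positions: each [subword_keep] pairs the
    two current heads. As it concerns only [s] and [s'], the matching is a relation. *)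
Lemma subword_matching (L : Type) (le : L -> L -> Prop) n n'
    (lab : 'I_n -> L) (lab' : 'I_n' -> L) (s : seq 'I_n) (s' : seq 'I_n') :
  sorted (fun i j : 'I_n => i < j) s -> sorted (fun i j : 'I_n' => i < j) s' ->
  subword le (map lab s) (map lab' s') ->
  exists F : 'I_n -> 'I_n' -> Prop, [/\
    forall x, x \in s -> exists y, F x y,
    forall x y, F x y -> [/\ x \in s, y \in s' & le (lab x) (lab' y)] &
    forall x y x' y', F x y -> F x' y' -> x < x' -> y < y'].
Proof.
have tr m : transitive (fun i j : 'I_m => i < j).
  by move=> ? ? ?; apply: ltn_trans.
move=> ss ss' emb.
move: {1 2}(map lab s) {1 2}(map lab' s') emb (erefl (map lab s)) (erefl (map lab' s')).
move=> u v emb; elim: emb s s' ss ss' => {u v} [v|b u v _ IH|a b u v le_ab _ IH] s s'.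
- by case: s => // _ _ _ _; exists (fun _ _ => False); split.
- case: s' => // y s' ss; rewrite /= (path_sortedE (@tr _)) => /andP[_ ss'] su [_ sv].
  have [F [Fex Fin Fmono]] := IH s s' ss ss' su sv.
  exists F; split=> // x z /Fin[xs zs' le_xz].
  by split=> //; rewrite inE zs' orbT.
case: s => // x s; case: s' => // y s' /=; rewrite !path_sortedE; try exact: tr.
move=> /andP[/allP xs ss] /andP[/allP ys' ss'] [ax su] [by_ sv].
have [F [Fex Fin Fmono]] := IH s s' ss ss' su sv.
exists (fun z w => (z = x /\ w = y) \/ F z w); split.
- move=> z; rewrite inE => /orP[/eqP->|/Fex[w Fzw]]; first by exists y; left.
  by exists w; right.
- move=> z w [[-> ->]|/Fin[zs ws' le_zw]]; first by rewrite !inE !eqxx -ax -by_.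
  by rewrite !inE zs ws' !orbT.
move=> z w z' w' [[-> ->]|Fzw] [[-> ->]|Fzw'].
- by rewrite ltnn.
- by move=> _; have [_ /ys'] := Fin _ _ Fzw'.
- by have [/xs xz _ _] := Fin _ _ Fzw; rewrite ltnNge ltnW.
exact: Fmono Fzw Fzw'.
Qed.

(** * Labelled permutations, and gaps in a split permutation *)

Lemma labelled_le_quasi_order (C : perm_class) (L : Type) (le : L -> L -> Prop) :
  quasi_order le -> quasi_order (@labelled_le C L le).
Proof.
move=> [lexx le_trans]; split=> [a|a b c [f [[fm fo] fl]] [g [[gm go] gl]]].
  by exists id; split.
exists (g \o f); split; last by move=> j; apply: le_trans (fl j) (gl _).
split=> [i j /fm /gm //|i j].
by rewrite fo /= go.
Qed.

(* The threshold of [Some i] is the value of the [i]-th left entry; that of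
   [None] exceeds all values, so [gap p l x None] says that [x] lies above
   every left entry. *)
Definition threshold k n (p : 'S_n) (l : 'I_k -> 'I_n) (o : option 'I_k) : nat :=
  if o is Some i then p (l i) else n.

Definition gap k n (p : 'S_n) (l : 'I_k -> 'I_n) (x : 'I_n) (o : option 'I_k) :=
  (p x < threshold p l o) &&
  [forall j, (p x < p (l j)) ==> (threshold p l o <= p (l j))].

Section Gap.
Variables (k n : nat) (p : 'S_n) (l : 'I_k -> 'I_n).

(** Minimality against [None] comes for free: its threshold [n] bounds all others. *)
Lemma gapP x o : reflect
  (p x < threshold p l o /\
   forall o', p x < threshold p l o' -> threshold p l o <= threshold p l o')
  (gap p l x o).
Proof.
apply: (iffP andP) => -[lt_x min_o]; split=> //.
  case=> [j|_ /=]; first exact: (implyP (forallP min_o j)).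
  by case: o {lt_x min_o} => //= i; apply: ltnW.
by apply/forallP=> j; apply/implyP; apply: (min_o (Some j)).
Qed.

Lemma gap_exists x : exists o, gap p l x o.
Proof.
have None_ok : p x < threshold p l None by apply: ltn_ord.
case: (@arg_minnP _ None (fun o => p x < threshold p l o) (threshold p l)) => // o ? ?.
by exists o; apply/gapP.
Qed.

Lemma gap_le x o x' o' : gap p l x o -> gap p l x' o' ->
  p x <= p x' -> threshold p l o <= threshold p l o'.
Proof. by move=> /gapP[_ minx] /gapP[ltx' _] /leq_ltn_trans/(_ ltx')/minx. Qed.

End Gap.

Definition gap_word k n (L : Type) (p : 'S_n) (l : 'I_k -> 'I_n) (lab : 'I_n -> L)
    (o : option 'I_k) : seq L :=
  [seq lab x | x : 'I_n <- enum 'I_n & (k <= x) && gap p l x o].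

(* [d] is true when the right part increases, false when it decreases. *)
Definition juxt_split (d : bool) k n (s : 'S_k) (p : 'S_n) (l : 'I_k -> 'I_n) : Prop :=
  [/\ forall i, l i = i :> nat, order_iso (p \o l) s &
      forall x x' : 'I_n, k <= x -> x < x' -> (p x < p x') = d].

(** The direction [d] is chosen before the permutation, so that any two members of the juxtaposition
    share it. *)
Lemma juxt_memP (C D : perm_class) : monotone_class D ->
  exists d, forall n (p : 'S_n), juxt_mem C D p ->
    exists k (s : 'S_k) l, C k s /\ juxt_split d s p l.
Proof.
move=> hD.
have [d dP] : exists d, forall m (t : 'S_m), D m t ->
    forall i j : 'I_m, i < j -> (t i < t j) = d.
  case: hD => DE.
    by exists true => m t /DE/Av21P tP i j /tP ->.
  by exists false => m t /DE/Av12P tP i j /tP/ltnW; rewrite ltnNge => ->.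
exists d => n p [k [m [e [s [t [Cs Dt os ot]]]]]].
exists k, s, (fun i => cast_ord e (lshift m i)); split=> //; split=> // x x' kx xx'.
have kx' := leq_trans kx (ltnW xx').
have right (z : 'I_n) (kz : k <= z) : exists j : 'I_m, z = cast_ord e (rshift k j).
  have ltj : z - k < m by rewrite ltn_subLR // e.
  by exists (Ordinal ltj); apply: val_inj; rewrite /= subnKC.
have [j xE] := right x kx; have [j' x'E] := right x' kx'.
move: xx'; rewrite xE x'E ot /= ltn_add2l; exact: dP.
Qed.

(** * From an embedding of codes to an embedding of permutations *)

Lemma split_embedding (L : Type) (le : L -> L -> Prop) (d : bool)
    k n (s : 'S_k) (p : 'S_n) (l : 'I_k -> 'I_n) (lab : 'I_n -> L)
    k' n' (s' : 'S_k') (p' : 'S_n') (l' : 'I_k' -> 'I_n') (lab' : 'I_n' -> L)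
    (h : 'I_k -> 'I_k') :
  juxt_split d s p l -> juxt_split d s' p' l' -> embedding s s' h ->
  (forall i, le (lab (l i)) (lab' (l' (h i)))) ->
  (forall o, subword le (gap_word p l lab o) (gap_word p' l' lab' (omap h o))) ->
  exists f : 'I_n -> 'I_n', embedding p p' f /\ forall x, le (lab x) (lab' (f x)).
Proof.
move=> [lE os mono] [lE' os' mono'] [hmono ho] hlab hword.
pose T := threshold p l; pose T' := threshold p' l'.
have T_lt i j : (T' (Some (h i)) < T' (Some (h j))) = (T (Some i) < T (Some j)).
  by rewrite /T /T' /= (os' (h i) (h j)) -[LHS]ho -(os i j).
(* Thus [omap h] carries gaps to gaps in the same vertical order, the top one to the top one. *)
have T_le o1 o2 : (T' (omap h o1) <= T' (omap h o2)) = (T o1 <= T o2).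
  case: o1 o2 => [i|] [j|]; first by rewrite leqNgt T_lt -leqNgt.
  - by rewrite /T /T' /= !(ltnW (ltn_ord _)).
  - by rewrite /T /T' /= leqNgt ltn_ord [RHS]leqNgt ltn_ord.
  - by rewrite /T /T' /= !leqnn.
have ltk i : l i < k by rewrite lE.
have ltk' i : l' i < k' by rewrite lE'.
have sorted_word m (P : pred 'I_m) :
    sorted (fun i j : 'I_m => i < j) [seq x <- enum 'I_m | P x].
  apply: sorted_filter; first by move=> ? ? ?; apply: ltn_trans.
  have := iota_ltn_sorted 0 m; rewrite -val_enum_ord.
  by rewrite (@sorted_map _ _ val ltn).
have /choice[F FP] o := subword_matching (sorted_word _ _) (sorted_word _ _) (hword o).
have F_in o x y : F o x y ->
    [/\ k <= x, gap p l x o, k' <= y, gap p' l' y (omap h o) & le (lab x) (lab' y)].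
  have [_ Fin _] := FP o; move=> /Fin[]; rewrite !mem_filter.
  by move=> /andP[/andP[? ?] _] /andP[/andP[? ?] _].
have F_ex o (x : 'I_n) : k <= x -> gap p l x o -> exists y, F o x y.
  by have [Fex _ _] := FP o; move=> kx gx; apply: Fex; rewrite mem_filter kx gx mem_enum.
have F_mono o x y x1 y1 : F o x y -> F o x1 y1 -> x < x1 -> y < y1.
  by have [_ _] := FP o; apply.
(* The graph of the embedding: left entries follow [h], right entries the matching of their gap. *)
pose G x y := (exists2 i, x = l i & y = l' (h i)) \/ (exists o, F o x y).
have Gex x : exists y, G x y.
  case: (ltnP x k) => kx.
    exists (l' (h (Ordinal kx))); left; exists (Ordinal kx) => //.
    by apply: val_inj; rewrite /= lE.
  have [o /(F_ex _ _ kx)[y Fxy]] := gap_exists p l x.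
  by exists y; right; exists o.
have Glab x y : G x y -> le (lab x) (lab' y).
  by case=> [[i -> ->] | [o /F_in[]]].
have lI : injective l by move=> i j /(congr1 val) /=; rewrite !lE => /val_inj.
have T_inj : injective T.
  case=> [i|] [j|] //=; rewrite /T /=.
  - by move=> /val_inj/perm_inj/lI->.
  - by move=> E; have := ltn_ord (p (l i)); rewrite E ltnn.
  - by move=> E; have := ltn_ord (p (l j)); rewrite -E ltnn.
have gap_lt o1 o2 x1 y1 x2 y2 : F o1 x1 y1 -> F o2 x2 y2 -> o1 != o2 ->
    p x1 < p x2 -> p' y1 < p' y2.
  move=> /F_in[_ gx1 _ gy1 _] /F_in[_ gx2 _ gy2 _] neq_o ltp.
  rewrite ltnNge; apply/negP=> /(gap_le gy2 gy1).
  rewrite T_le leqNgt ltn_neqAle (inj_eq T_inj) neq_o.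
  by rewrite /T (gap_le gx1 gx2) // ltnW.
have Gpos x1 y1 x2 y2 : G x1 y1 -> G x2 y2 -> x1 < x2 -> y1 < y2.
  case=> [[i -> ->]|[o Fxy]] [[j -> ->]|[o' Fxy']].
  - by rewrite !lE !lE'; apply: hmono.
  - by have [_ _ ky _ _] := F_in _ _ _ Fxy' => _; apply: leq_trans ky.
  - have [kx _ _ _ _] := F_in _ _ _ Fxy.
    by rewrite ltnNge ltnW // (leq_trans (ltk j)).
  case: (eqVneq o o') Fxy' => [<-|neq_o] Fxy'; first exact: F_mono Fxy Fxy'.
  have [kx _ ky _ _] := F_in _ _ _ Fxy; have [kx' _ ky' _ _] := F_in _ _ _ Fxy'.
  (* In different gaps the value order of the images is known from [gap_lt]. Both right parts have
     direction [d], so it determines the order of positions. *)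
  move=> ltx; have dE := mono _ _ kx ltx.
  case: (ltngtP y1 y2) => // [lty|/val_inj eqy].
    have dE' := mono' _ _ ky' lty.
    case: ltngtP dE => [ltp|ltp|/val_inj/perm_inj eqx] dE.
    + have := gap_lt _ _ _ _ _ _ Fxy Fxy' neq_o ltp.
      by rewrite ltnNge ltnW // dE' -dE.
    + have := gap_lt _ _ _ _ _ _ Fxy' Fxy; rewrite eq_sym => /(_ neq_o ltp).
      by rewrite dE' -dE.
    + by rewrite eqx ltnn in ltx.
  case: (ltngtP (p x1) (p x2)) => [ltp|ltp|/val_inj/perm_inj eqx].
  + by have := gap_lt _ _ _ _ _ _ Fxy Fxy' neq_o ltp; rewrite eqy ltnn.
  + have := gap_lt _ _ _ _ _ _ Fxy' Fxy; rewrite eq_sym => /(_ neq_o ltp).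
    by rewrite eqy ltnn.
  + by rewrite eqx ltnn in ltx.
have Gval x1 y1 x2 y2 : G x1 y1 -> G x2 y2 -> p x1 < p x2 -> p' y1 < p' y2.
  case=> [[i -> ->]|[o Fxy]] [[j -> ->]|[o' Fxy']].
  - by move=> ltp; rewrite (T_lt i j).
  - have [kx /gapP[ltx _] ky /gapP[_ miny] _] := F_in _ _ _ Fxy' => ltp.
    (* If [y2] lay below the image of left entry [i], minimality of its gap would contradict this
       strict inequality, carried over by [T_le]. *)
    have lto : T (Some i) < T o' by apply: ltn_trans ltx.
    case: (ltngtP (p' y2) (p' (l' (h i)))) => // [lty|/val_inj/perm_inj eqy].
      by have := miny (Some (h i)) lty; rewrite (T_le o' (Some i)) leqNgt lto.
    by have := ltk' (h i); rewrite -eqy ltnNge ky.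
  - have [kx /gapP[_ minx] ky /gapP[lty _] _] := F_in _ _ _ Fxy.
    by move=> /(minx (Some j)); rewrite -(T_le o (Some j)); apply: leq_trans.
  case: (eqVneq o o') Fxy' => [<-|neq_o] Fxy'; last exact: gap_lt Fxy Fxy' neq_o.
  have [kx _ ky _ _] := F_in _ _ _ Fxy; have [kx' _ ky' _ _] := F_in _ _ _ Fxy'.
  (* Within one gap the matching preserves positions, and the common direction [d] converts this
     into value order. *)
  case: (ltngtP x1 x2) => [ltx|ltx|/val_inj->]; last by rewrite ltnn.
    by rewrite (mono _ _ kx ltx) (mono' _ _ ky (F_mono _ _ _ _ _ Fxy Fxy' ltx)).
  have dE := mono _ _ kx' ltx.
  have lty := F_mono _ _ _ _ _ Fxy' Fxy ltx; have dE' := mono' _ _ ky' lty.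
  move=> ltp; case: (ltngtP (p' y1) (p' y2)) dE' => // [_ dE'|/val_inj/perm_inj eqy].
    by move: dE; rewrite -dE' ltnNge ltnW.
  by rewrite eqy ltnn in lty.
have /choice[f fG] := Gex.
exists f; split=> [|x]; last exact: Glab.
split=> [i j|i j /=]; first exact: Gpos.
case: (ltngtP (p i) (p j)) => [pij|pji|/val_inj/perm_inj->]; last by rewrite ltnn.
  by rewrite (Gval _ _ _ _ (fG i) (fG j) pij).
by rewrite ltnNge ltnW // (Gval _ _ _ _ (fG j) (fG i) pji).
Qed.

Theorem theorem4p1 (C D : perm_class) (hC : lwqo C) (hD : monotone_class D) :
  lwqo (juxtaposition C D).
Proof.
move=> L le wle; have [qo _ _] := wle.
have [d dP] := juxt_memP C hD.
have wword := higman wle.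
(* The hypothesis on [C] is applied to the enlarged labels: an original label with the word of the
   gap below. The last factor holds the word of the top gap. *)
have wcode := wqo_prod (hC _ _ (wqo_prod wle wword)) wword.
apply: good_wqo; first exact: labelled_le_quasi_order.
pose code (a : labelled (juxtaposition C D) L) (c : labelled C (L * seq L) * seq L) :=
  exists l : 'I_(lab_length c.1) -> 'I_(lab_length a),
    [/\ juxt_split d (lab_perm c.1) (lab_perm a) l,
        forall i, label c.1 i =
          (label a (l i), gap_word (lab_perm a) l (label a) (Some i)) &
        c.2 = gap_word (lab_perm a) l (label a) None].
apply: (good_coding (code := code) _ _ (wqo_good wcode)).
  case=> n p pCD lab; have [k [s [l [Cs ls]]]] := dP n p pCD.
  exists (Labelled Cs (fun i => (lab (l i), gap_word p l lab (Some i))), gap_word p l lab None).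
  by exists l.
move=> a b [c cw] [c' cw'] [/= l [ls cl cwE]] [/= l' [ls' cl' cwE']].
move=> [/= [h [hemb hlab]] lew].
apply: (split_embedding ls ls' hemb) => [i|[i|]] /=.
- by have [] := hlab i; rewrite cl cl'.
- by have [] := hlab i; rewrite cl cl'.
by rewrite -cwE -cwE'.
Qed.
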